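(* Let $\mathsf{C}$, $\mathsf{C}'$ and $\mathsf{D}$ be monoidal categories, let $F:\mathsf{C}\to\mathsf{D}$ be a lax monoidal functor with unit $\eta_F$ and multiplication $\mu_F$, and let $G:\mathsf{C}\to\mathsf{C}'$ be a strong monoidal functor with unit $\eta_G$ and multiplication $\mu_G$. Let $L:\mathsf{C}'\to\mathsf{D}$ be a functor and $\lambda:F\Rightarrow L\circ G$ a natural transformation such that: (i) $(L,\lambda)$ is a left Kan extension of $F$ along $G$ in $\mathsf{Cat}$; (ii) $(L\otimes L,\lambda\otimes\lambda)$ is a left Kan extension of $F\otimes F:\mathsf{C}\times\mathsf{C}\to\mathsf{D}$ along $G\times G:\mathsf{C}\times\mathsf{C}\to\mathsf{C}'\times\mathsf{C}'$ in $\mathsf{Cat}$; (iii) $(L\otimes L\otimes L,\lambda\otimes\lambda\otimes\lambda)$ is a left Kan extension of $F\otimes F\otimes F:\mathsf{C}\times\mathsf{C}\times\mathsf{C}\to\mathsf{D}$ along $G\times G\times G$ in $\mathsf{Cat}$. Then: (a) There is a unique lax monoidal structure $(\eta_L,\mu_L)$ on $L$ which makes $\lambda$ into a monoidal natural transformation from $F$ to $L\circ G$, i.e. such that $$L(\eta_G)\circ\eta_L=\lambda_{e_{\mathsf{C}}}\circ\eta_F \;:\; e_{\mathsf{D}}\to L(G(e_{\mathsf{C}}))$$ and, for all objects $c,c'$ of $\mathsf{C}$, $$L\big((\mu_G)_{c,c'}\big)\circ(\mu_L)_{Gc,Gc'}\circ(\lambda_c\otimes\lambda_{c'})=\lambda_{c\otimes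 c'}\circ(\mu_F)_{c,c'}\;:\;F(c)\otimes F(c')\to L(G(c\otimes c')).$$ (b) With this lax monoidal structure on $L$, $(L,\lambda)$ is also a left Kan extension of $F$ along $G$ in the 2-category $\mathsf{MonCat}$.
   Context: Monoidal categories are not assumed strict. For a monoidal category $\mathsf{C}$, $e_{\mathsf{C}}$ denotes the unit object and $\otimes:\mathsf{C}\times\mathsf{C}\to\mathsf{C}$ the tensor product. A lax monoidal functor $F:\mathsf{C}\to\mathsf{D}$ has a unit morphism $\eta_F:e_{\mathsf{D}}\to F(e_{\mathsf{C}})$ and a natural multiplication $(\mu_F)_{c,c'}:F(c)\otimes F(c')\to F(c\otimes c')$ satisfying the usual associativity and left and right unit laws; it is strong monoidal if $\eta_F$ and all $(\mu_F)_{c,c'}$ are isomorphisms. $\mathsf{MonCat}$ is the 2-category of monoidal categories, lax monoidal functors, and monoidal natural transformations. Composites of lax monoidal functors carry their usual lax monoidal structure; e.g. $L\circ G$ has unit $L(\eta_G)\circ\eta_L$ and multiplication $L((\mu_G)_{c,c'})\circ(\mu_L)_{Gc,Gc'}$. For functors $H,K:\mathsf{A}\to\mathsf{D}$ into a monoidal category $\mathsf{D}$ and a natural transformation $\alpha:H\Rightarrow K$, $H\otimes H:\mathsf{A}\times\mathsf{A}\to\mathsf{D}$ is the composite $\otimes\circ(H\times H)$, i.e. $(a,a')\mapsto H(a)\otimes H(a')$, and $\alpha\otimes\alpha:H\otimes H\Rightarrow K\otimes K$ has components $\alpha_a\otimes\alpha_{a'}$. Similarly, $H\otimes H\otimes H:\mathsf{A}\times\mathsf{A}\times\mathsf{A}\to\mathsf{D}$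 is $(a,a',a'')\mapsto (H(a)\otimes H(a'))\otimes H(a'')$, and $\alpha\otimes\alpha\otimes\alpha$ has components $(\alpha_a\otimes\alpha_{a'})\otimes\alpha_{a''}$ (the choice of bracketing is immaterial up to the associator). In particular $\lambda\otimes\lambda$ is a transformation $F\otimes F\Rightarrow (L\otimes L)\circ(G\times G)$, and likewise for the triple version. Left Kan extension in $\mathsf{Cat}$: given functors $F:\mathsf{A}\to\mathsf{D}$ and $G:\mathsf{A}\to\mathsf{B}$, a pair $(L,\lambda)$ with $L:\mathsf{B}\to\mathsf{D}$ a functor and $\lambda:F\Rightarrow L\circ G$ a natural transformation is a left Kan extension of $F$ along $G$ if for every functor $X:\mathsf{B}\to\mathsf{D}$ the map $u\mapsto (uG)\circ\lambda$ is a bijection from natural transformations $L\Rightarrow X$ to natural transformations $F\Rightarrow X\circ G$. (Kan extensions are not assumed to be pointwise.) Left Kan extension in $\mathsf{MonCat}$: the same notion with all functors lax monoidal and all transformations monoidal; that is, $\lambda:F\Rightarrow L\circ G$ is a monoidal natural transformation of lax monoidal functors, and for every lax monoidal functor $X:\mathsf{C}'\to\mathsf{D}$ the map $u\mapsto (uG)\circ\lambda$ is a bijection from monoidal natural transformations $L\Rightarrow X$ to monoidal natural transformations $F\Rightarrow X\circ G$. *)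

(* Defs.v *)
Set Implicit Arguments.
Unset Strict Implicit.
Unset Printing Implicit Defensive.

Declare Scope cat_scope.
Delimit Scope cat_scope with cat.
Local Open Scope cat_scope.

Reserved Notation "g ∘ f" (at level 40, left associativity).
Reserved Notation "a ⊗ b" (at level 35, right associativity).
Reserved Notation "f ⊗₁ g" (at level 35, right associativity).

Record Category : Type := {
  ob :> Type;
  Hom : ob -> ob -> Type;
  idm : forall a, Hom a a;
  comp : forall a b c, Hom b c -> Hom a b -> Hom a c;
  comp_id_l : forall a b (f : Hom a b), comp (idm b) f = f;
  comp_id_r : forall a b (f : Hom a b), comp f (idm a) = f;
  comp_assoc : forall a b c d (h : Hom c d) (g : Hom b c) (f : Hom a b),
      comp (comp h g) f = comp h (comp g f)
}.
Arguments Hom {_} _ _.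
Arguments idm {_} a.
Arguments comp {_ a b c} _ _.
Notation "g ∘ f" := (comp g f) : cat_scope.

Definition IsIso (A : Category) (a b : A) (f : Hom a b) : Prop :=
  exists g : Hom b a, g ∘ f = idm a /\ f ∘ g = idm b.

Record Functor (A B : Category) : Type := {
  fobj :> A -> B;
  fmap : forall a a', Hom a a' -> Hom (fobj a) (fobj a');
  fmap_id : forall a, fmap (idm a) = idm (fobj a);
  fmap_comp : forall a b c (g : Hom b c) (f : Hom a b),
      fmap (g ∘ f) = fmap g ∘ fmap f
}.
Arguments fmap {A B} _ {a a'} _.

Definition compF (A B C : Category) (K : Functor B C) (H : Functor A B) :
  Functor A C.
Proof.
  refine {| fobj := fun a => K (H a); fmap := fun _ _ f => fmap K (fmap H f) |}.
  - intros a. rewrite !fmap_id. reflexivity.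
  - intros a b c g f. rewrite !fmap_comp. reflexivity.
Defined.

Record NatTrans (A B : Category) (H K : Functor A B) : Type := {
  component :> forall a : A, Hom (H a) (K a);
  naturality : forall (a b : A) (f : Hom a b),
      component b ∘ fmap H f = fmap K f ∘ component a
}.

(* The transformation (u G) ∘ l for l : F ⇒ L G and u : L ⇒ X. *)
Definition paste (A B D : Category) (F : Functor A D) (G : Functor A B)
  (L X : Functor B D) (l : NatTrans F (compF L G)) (u : NatTrans L X) :
  NatTrans F (compF X G).
Proof.
  refine (@Build_NatTrans A D F (compF X G)
            (fun a => u (G a) ∘ (l a : Hom (F a) (L (G a)))) _).
  intros a b f. simpl.
  pose proof (naturality l f) as E. simpl in E.
  rewrite comp_assoc, E.
  rewrite <- comp_assoc, naturality.
  apply comp_assoc.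
Defined.

Definition IsBijection (S T : Type) (f : S -> T) : Prop :=
  forall y : T, exists! x : S, f x = y.

Definition IsLeftKan (A B D : Category) (F : Functor A D) (G : Functor A B)
  (L : Functor B D) (l : NatTrans F (compF L G)) : Prop :=
  forall X : Functor B D, IsBijection (fun u : NatTrans L X => paste l u).

Definition prodC (A B : Category) : Category.
Proof.
  refine {|
    ob := (A * B)%type;
    Hom := fun x y => (Hom (fst x) (fst y) * Hom (snd x) (snd y))%type;
    idm := fun x => (idm (fst x), idm (snd x));
    comp := fun _ _ _ g f => (fst g ∘ fst f, snd g ∘ snd f)
  |}.
  - intros a b [f1 f2]. simpl. rewrite !comp_id_l. reflexivity.
  - intros a b [f1 f2]. simpl. rewrite !comp_id_r. reflexivity.
  - intros a b c d h g f. simpl. rewrite !comp_assoc. reflexivity.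
Defined.

Definition prodF (A B A' B' : Category) (H : Functor A B) (K : Functor A' B') :
  Functor (prodC A A') (prodC B B').
Proof.
  refine (@Build_Functor (prodC A A') (prodC B B')
            (fun x => (H (fst x), K (snd x)))
            (fun _ _ f => (fmap H (fst f), fmap K (snd f))) _ _).
  - intros x. simpl. rewrite !fmap_id. reflexivity.
  - intros x y z g f. simpl. rewrite !fmap_comp. reflexivity.
Defined.

Definition prodN (A B A' B' : Category) (H H' : Functor A B)
  (K K' : Functor A' B') (s : NatTrans H H') (t : NatTrans K K') :
  NatTrans (prodF H K) (prodF H' K').
Proof.
  refine (@Build_NatTrans _ _ (prodF H K) (prodF H' K')
            (fun x => (s (fst x), t (snd x))) _).
  intros x y f. simpl. rewrite !naturality. reflexivity.
Defined.

(* The action T α : T H ⇒ T K of a functor T on a transformation α : H ⇒ K. *)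
Definition whiskerL (A B C : Category) (T : Functor B C) (H K : Functor A B)
  (t : NatTrans H K) : NatTrans (compF T H) (compF T K).
Proof.
  refine (@Build_NatTrans _ _ (compF T H) (compF T K) (fun a => fmap T (t a)) _).
  intros a b f. simpl. rewrite <- !fmap_comp, naturality. reflexivity.
Defined.

Definition tensO (A : Category) (T : Functor (prodC A A) A) (a b : A) : A :=
  T (a, b).

Definition tensM (A : Category) (T : Functor (prodC A A) A) (a a' b b' : A)
  (f : Hom a a') (g : Hom b b') : Hom (tensO T a b) (tensO T a' b') :=
  @fmap _ _ T (a, b) (a', b') (f, g).

Record MonoidalCategory : Type := {
  carrier :> Category;
  tensor : Functor (prodC carrier carrier) carrier;
  munit : carrier;
  assoc : forall a b c : carrier,
      Hom (tensO tensor (tensO tensor a b) c) (tensO tensor a (tensO tensor b c));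
  lunit : forall a : carrier, Hom (tensO tensor munit a) a;
  runit : forall a : carrier, Hom (tensO tensor a munit) a;
  assoc_iso : forall a b c, IsIso (assoc a b c);
  lunit_iso : forall a, IsIso (lunit a);
  runit_iso : forall a, IsIso (runit a);
  assoc_natural : forall a a' b b' c c' (f : Hom a a') (g : Hom b b') (h : Hom c c'),
      assoc a' b' c' ∘ tensM tensor (tensM tensor f g) h
      = tensM tensor f (tensM tensor g h) ∘ assoc a b c;
  lunit_natural : forall a b (f : Hom a b),
      lunit b ∘ tensM tensor (idm munit) f = f ∘ lunit a;
  runit_natural : forall a b (f : Hom a b),
      runit b ∘ tensM tensor f (idm munit) = f ∘ runit a;
  triangle : forall a b,
      tensM tensor (idm a) (lunit b) ∘ assoc a munit b
      = tensM tensor (runit a) (idm b);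
  pentagon : forall a b c d,
      tensM tensor (idm a) (assoc b c d)
        ∘ assoc a (tensO tensor b c) d
        ∘ tensM tensor (assoc a b c) (idm d)
      = assoc a b (tensO tensor c d) ∘ assoc (tensO tensor a b) c d
}.
Arguments munit _ : clear implicits.

Notation "a ⊗ b" := (tensO (tensor _) a b) : cat_scope.
Notation "f ⊗₁ g" := (tensM (tensor _) f g) : cat_scope.

(* H ⊗ H and (H ⊗ H) ⊗ H, with triples in A bracketed as (A × A) × A. *)
Definition tens2F (A : Category) (D : MonoidalCategory) (H : Functor A D) :
  Functor (prodC A A) D :=
  compF (tensor D) (prodF H H).

Definition tens3F (A : Category) (D : MonoidalCategory) (H : Functor A D) :
  Functor (prodC (prodC A A) A) D :=
  compF (tensor D) (prodF (tens2F H) H).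

Definition tens2N (A : Category) (D : MonoidalCategory) (H K : Functor A D)
  (t : NatTrans H K) : NatTrans (tens2F H) (tens2F K) :=
  whiskerL (tensor D) (prodN t t).

Definition tens3N (A : Category) (D : MonoidalCategory) (H K : Functor A D)
  (t : NatTrans H K) : NatTrans (tens3F H) (tens3F K) :=
  whiskerL (tensor D) (prodN (tens2N t) t).

(* tens2F (L G) and (tens2F L) (G × G) agree definitionally on objects and
   morphisms, but as records they differ in their proof fields; hence the
   components of tens2N and tens3N are repackaged at the latter type. *)
Definition tens2_along (A B : Category) (D : MonoidalCategory)
  (F : Functor A D) (G : Functor A B) (L : Functor B D)
  (l : NatTrans F (compF L G)) :
  NatTrans (tens2F F) (compF (tens2F L) (prodF G G)) :=
  @Build_NatTrans _ _ (tens2F F) (compF (tens2F L) (prodF G G))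
    (component (tens2N l)) (naturality (tens2N l)).

Definition tens3_along (A B : Category) (D : MonoidalCategory)
  (F : Functor A D) (G : Functor A B) (L : Functor B D)
  (l : NatTrans F (compF L G)) :
  NatTrans (tens3F F) (compF (tens3F L) (prodF (prodF G G) G)) :=
  @Build_NatTrans _ _ (tens3F F) (compF (tens3F L) (prodF (prodF G G) G))
    (component (tens3N l)) (naturality (tens3N l)).

Definition mult_at (C D : MonoidalCategory) (F : Functor C D)
  (m : NatTrans (tens2F F) (compF F (tensor C))) (c c' : C) :
  Hom (F c ⊗ F c') (F (c ⊗ c')) := m (c, c').

Record LaxStructure (C D : MonoidalCategory) (F : Functor C D) : Type := {
  eta : Hom (munit D) (F (munit C));
  mult : NatTrans (tens2F F) (compF F (tensor C));
  lax_assoc : forall a b c : C,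
      fmap F (assoc a b c) ∘ mult_at mult (a ⊗ b) c ∘ (mult_at mult a b ⊗₁ idm (F c))
      = mult_at mult a (b ⊗ c) ∘ (idm (F a) ⊗₁ mult_at mult b c)
          ∘ assoc (F a) (F b) (F c);
  lax_lunit : forall a : C,
      fmap F (lunit a) ∘ mult_at mult (munit C) a ∘ (eta ⊗₁ idm (F a)) = lunit (F a);
  lax_runit : forall a : C,
      fmap F (runit a) ∘ mult_at mult a (munit C) ∘ (idm (F a) ⊗₁ eta) = runit (F a)
}.

Record LaxFunctor (C D : MonoidalCategory) : Type := {
  lax_functor :> Functor C D;
  lax_structure : LaxStructure lax_functor
}.

Definition etaF (C D : MonoidalCategory) (F : LaxFunctor C D) :
  Hom (munit D) (F (munit C)) := eta (lax_structure F).

Definition muF (C D : MonoidalCategory) (F : LaxFunctor C D) (c c' : C) :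
  Hom (F c ⊗ F c') (F (c ⊗ c')) := mult_at (mult (lax_structure F)) c c'.

Definition IsStrong (C D : MonoidalCategory) (F : LaxFunctor C D) : Prop :=
  IsIso (etaF F) /\ forall c c' : C, IsIso (muF F c c').

Lemma tensM_comp (D : MonoidalCategory) (a a' a'' b b' b'' : D)
  (f' : Hom a' a'') (f : Hom a a') (g' : Hom b' b'') (g : Hom b b') :
  (f' ∘ f) ⊗₁ (g' ∘ g) = (f' ⊗₁ g') ∘ (f ⊗₁ g).
Proof.
  exact (@fmap_comp _ _ (tensor D) (a, b) (a', b') (a'', b'') (f', g') (f, g)).
Qed.

Lemma mult_natural (C D : MonoidalCategory) (F : Functor C D)
  (m : NatTrans (tens2F F) (compF F (tensor C))) (a a' b b' : C)
  (f : Hom a a') (g : Hom b b') :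
  mult_at m a' b' ∘ (fmap F f ⊗₁ fmap F g) = fmap F (f ⊗₁ g) ∘ mult_at m a b.
Proof.
  exact (@naturality _ _ _ _ m (a, b) (a', b') (f, g)).
Qed.

Definition comp_mult (B C D : MonoidalCategory)
  (L : LaxFunctor C D) (G : LaxFunctor B C) :
  NatTrans (tens2F (compF L G)) (compF (compF L G) (tensor B)).
Proof.
  refine (@Build_NatTrans _ _ (tens2F (compF L G)) (compF (compF L G) (tensor B))
    (fun x => fmap L (mult (lax_structure G) x)
              ∘ mult (lax_structure L) (prodF G G x)) _).
  intros [a b] [a' b'] [f g].
  change (fmap L (muF G a' b') ∘ muF L (G a') (G b')
            ∘ (fmap L (fmap G f) ⊗₁ fmap L (fmap G g))
          = fmap L (fmap G (f ⊗₁ g)) ∘ (fmap L (muF G a b) ∘ muF L (G a) (G b))).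
  unfold muF.
  rewrite comp_assoc, mult_natural, <- !comp_assoc, <- !fmap_comp, mult_natural.
  reflexivity.
Defined.

Definition comp_structure (B C D : MonoidalCategory)
  (L : LaxFunctor C D) (G : LaxFunctor B C) : LaxStructure (compF L G).
Proof.
  refine (@Build_LaxStructure B D (compF L G)
            (fmap L (etaF G) ∘ etaF L) (comp_mult L G) _ _ _).
  - intros a b c.
    change (fmap L (fmap G (assoc a b c))
              ∘ (fmap L (muF G (a ⊗ b) c) ∘ muF L (G (a ⊗ b)) (G c))
              ∘ ((fmap L (muF G a b) ∘ muF L (G a) (G b)) ⊗₁ idm (L (G c)))
            = (fmap L (muF G a (b ⊗ c)) ∘ muF L (G a) (G (b ⊗ c)))
              ∘ (idm (L (G a)) ⊗₁ (fmap L (muF G b c) ∘ muF L (G b) (G c)))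
              ∘ assoc (L (G a)) (L (G b)) (L (G c))).
    rewrite <- (comp_id_l (idm (L (G c)))), <- (comp_id_l (idm (L (G a)))).
    rewrite !tensM_comp, <- (fmap_id L (G c)), <- (fmap_id L (G a)).
    unfold muF. rewrite !comp_assoc.
    rewrite <- (comp_assoc (mult_at (mult (lax_structure L)) (G (a ⊗ b)) (G c))).
    rewrite <- (comp_assoc (mult_at (mult (lax_structure L)) (G a) (G (b ⊗ c)))).
    rewrite !mult_natural, !fmap_id, !comp_assoc.
    rewrite <- !(comp_assoc (mult_at (mult (lax_structure L)) (G a) _)).
    pose proof (lax_assoc (lax_structure L) (G a) (G b) (G c)) as E.
    pose proof (lax_assoc (lax_structure G) a b c) as E'.
    rewrite <- E, <- !comp_assoc, <- !fmap_comp, E'. reflexivity.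
  - intros a.
    change (fmap L (fmap G (lunit a))
              ∘ (fmap L (muF G (munit B) a) ∘ muF L (G (munit B)) (G a))
              ∘ ((fmap L (etaF G) ∘ etaF L) ⊗₁ idm (L (G a)))
            = lunit (L (G a))).
    rewrite <- (comp_id_l (idm (L (G a)))), tensM_comp, <- (fmap_id L (G a)).
    unfold muF. rewrite !comp_assoc.
    rewrite <- (comp_assoc (mult_at (mult (lax_structure L)) _ _)).
    rewrite mult_natural, fmap_id.
    rewrite <- !comp_assoc, <- !fmap_comp.
    unfold etaF. rewrite (lax_lunit (lax_structure G) a).
    exact (lax_lunit (lax_structure L) (G a)).
  - intros a.
    change (fmap L (fmap G (runit a))
              ∘ (fmap L (muF G a (munit B)) ∘ muF L (G a) (G (munit B)))
              ∘ (idm (L (G a)) ⊗₁ (fmap L (etaF G) ∘ etaF L))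
            = runit (L (G a))).
    rewrite <- (comp_id_l (idm (L (G a)))), tensM_comp, <- (fmap_id L (G a)).
    unfold muF. rewrite !comp_assoc.
    rewrite <- (comp_assoc (mult_at (mult (lax_structure L)) _ _)).
    rewrite mult_natural, fmap_id.
    rewrite <- !comp_assoc, <- !fmap_comp.
    unfold etaF. rewrite (lax_runit (lax_structure G) a).
    exact (lax_runit (lax_structure L) (G a)).
Defined.

Definition compLax (B C D : MonoidalCategory)
  (L : LaxFunctor C D) (G : LaxFunctor B C) : LaxFunctor B D :=
  {| lax_functor := compF L G; lax_structure := comp_structure L G |}.

Definition IsMonoidal (C D : MonoidalCategory) (H K : LaxFunctor C D)
  (t : NatTrans H K) : Prop :=
  etaF K = t (munit C) ∘ etaF H /\
  forall c c' : C, muF K c c' ∘ (t c ⊗₁ t c') = t (c ⊗ c') ∘ muF H c c'.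

Record MonNatTrans (C D : MonoidalCategory) (H K : LaxFunctor C D) : Type := {
  mon_nat :> NatTrans H K;
  mon_nat_monoidal : IsMonoidal mon_nat
}.

Definition mon_paste (A B D : MonoidalCategory) (F : LaxFunctor A D)
  (G : LaxFunctor A B) (L X : LaxFunctor B D)
  (l : MonNatTrans F (compLax L G)) (u : MonNatTrans L X) :
  MonNatTrans F (compLax X G).
Proof.
  refine (@Build_MonNatTrans A D F (compLax X G) (paste l u) _).
  destruct l as [l [l0 l2]], u as [u [u0 u2]]; cbn [mon_nat].
  pose (l' := component l : forall a, Hom (F a) (L (G a))).
  split.
  - change (fmap X (etaF G) ∘ etaF X = u (G (munit A)) ∘ l' (munit A) ∘ etaF F).
    change (fmap L (etaF G) ∘ etaF L = l' (munit A) ∘ etaF F) in l0.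
    rewrite comp_assoc, <- l0, u0, <- !comp_assoc, naturality. reflexivity.
  - intros c c'. specialize (l2 c c').
    change (fmap X (muF G c c') ∘ muF X (G c) (G c')
              ∘ ((u (G c) ∘ l' c) ⊗₁ (u (G c') ∘ l' c'))
            = u (G (c ⊗ c')) ∘ l' (c ⊗ c') ∘ muF F c c').
    change (fmap L (muF G c c') ∘ muF L (G c) (G c') ∘ (l' c ⊗₁ l' c')
            = l' (c ⊗ c') ∘ muF F c c') in l2.
    rewrite tensM_comp, comp_assoc.
    rewrite <- (comp_assoc (muF X (G c) (G c'))), u2.
    rewrite <- !comp_assoc, <- naturality.
    rewrite (comp_assoc (u (G (c ⊗ c'))) (l' (c ⊗ c'))), <- l2, <- !comp_assoc.
    reflexivity.
Defined.

Definition IsMonLeftKan (A B D : MonoidalCategory) (F : LaxFunctor A D)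
  (G : LaxFunctor A B) (L : LaxFunctor B D)
  (l : MonNatTrans F (compLax L G)) : Prop :=
  forall X : LaxFunctor B D,
    IsBijection (fun u : MonNatTrans L X => mon_paste l u).

(* Main.v *)
(** The multiplication [mu_L] is the transformation that the extension property
    of [L ⊗ L] assigns to [L(mu_G)^-1 ∘ λ ∘ mu_F], and
    [eta_L = L(eta_G)^-1 ∘ λ ∘ eta_F].  Every law is an equation of transformations out of [L], [L ⊗ L] or [(L ⊗ L) ⊗ L], so it can be
    tested on the image of [G] after precomposition with λ; there, up to the
    isomorphisms [L(eta_G)] and [L(mu_G)], it is the corresponding law of [F].
    For the unit laws the source is [e ⊗ L] or [L ⊗ e], which is isomorphic to [L],
    so that no Kan extension property beyond that of [L] is needed. *)

Require Import Defs.
From Stdlib Require Import FunctionalExtensionality ProofIrrelevance IndefiniteDescription.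

Set Implicit Arguments.
Unset Strict Implicit.
Unset Printing Implicit Defensive.

Local Open Scope cat_scope.

(** * Extensionality, and separation of transformations by a Kan extension *)

Lemma NatTrans_ext (A B : Category) (H K : Functor A B) (s t : NatTrans H K) :
  (forall a, s a = t a) -> s = t.
Proof.
  destruct s as [s ns], t as [t nt]; cbn; intros E.
  assert (s = t) as E' by (apply functional_extensionality_dep; exact E).
  destruct E'. f_equal. apply proof_irrelevance.
Qed.

Lemma NatTrans_eq_at (A B : Category) (H K : Functor A B) (s t : NatTrans H K) :
  s = t -> forall a, s a = t a.
Proof. intros <- a. reflexivity. Qed.

Lemma LaxStructure_ext (A B : MonoidalCategory) (H : Functor A B)
  (S T : LaxStructure H) : eta S = eta T -> mult S = mult T -> S = T.
Proof.
  destruct S as [e m ? ? ?], T as [e' m' ? ? ?]; cbn; intros <- <-.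
  f_equal; apply proof_irrelevance.
Qed.

Lemma MonNatTrans_ext (A B : MonoidalCategory) (H K : LaxFunctor A B)
  (s t : MonNatTrans H K) : mon_nat s = mon_nat t -> s = t.
Proof.
  destruct s as [s ms], t as [t mt]; cbn; intros <-.
  f_equal; apply proof_irrelevance.
Qed.

(** The injectivity half of the universal property in pointwise form: [u] and [v] are both the
    unique preimage of [paste l v]. *)
Lemma kan_separates (A B D : Category) (F : Functor A D) (G : Functor A B)
  (L : Functor B D) (l : NatTrans F (compF L G)) (kan : IsLeftKan l)
  (X : Functor B D) (u v : NatTrans L X) :
  (forall a, u (G a) ∘ (l a : Hom (F a) (L (G a))) = v (G a) ∘ l a) ->
  forall b, u b = v b.
Proof.
  intros E b.
  destruct (kan X (paste l v)) as [w [_ Hw]].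
  rewrite <- (Hw u), <- (Hw v); [reflexivity | reflexivity |].
  apply NatTrans_ext. exact E.
Qed.

(** * Isomorphisms *)

Lemma IsIso_fmap (A B : Category) (H : Functor A B) (a b : A) (f : Hom a b) :
  IsIso f -> IsIso (fmap H f).
Proof.
  intros [g [gf fg]]. exists (fmap H g).
  rewrite <- !fmap_comp, gf, fg, !fmap_id. split; reflexivity.
Qed.

Lemma IsIso_comp (A : Category) (a b c : A) (g : Hom b c) (f : Hom a b) :
  IsIso g -> IsIso f -> IsIso (g ∘ f).
Proof.
  intros [g' [g1 g2]] [f' [f1 f2]]. exists (f' ∘ g'). split.
  - rewrite comp_assoc, <- (comp_assoc g'), g1, comp_id_l. exact f1.
  - rewrite comp_assoc, <- (comp_assoc f), f2, comp_id_l. exact g2.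
Qed.

Lemma IsIso_tens_l (D : MonoidalCategory) (a b c : D) (f : Hom b c) :
  IsIso f -> IsIso (idm a ⊗₁ f).
Proof.
  intros [g [gf fg]].
  exact (@IsIso_fmap _ _ (tensor D) (a, b) (a, c) (idm a, f)
    (ex_intro _ (idm a, g)
      (conj (f_equal2 pair (comp_id_l _) gf) (f_equal2 pair (comp_id_l _) fg)))).
Qed.

Lemma iso_cancel_l (A : Category) (a b c : A) (h : Hom b c) (f g : Hom a b) :
  IsIso h -> h ∘ f = h ∘ g -> f = g.
Proof.
  intros [k [kh _]] E.
  rewrite <- (comp_id_l f), <- kh, comp_assoc, E, <- comp_assoc, kh, comp_id_l.
  reflexivity.
Qed.

Lemma iso_cancel_r (A : Category) (a b c : A) (h : Hom a b) (f g : Hom b c) :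
  IsIso h -> f ∘ h = g ∘ h -> f = g.
Proof.
  intros [k [_ hk]] E.
  rewrite <- (comp_id_r f), <- hk, <- comp_assoc, E, comp_assoc, hk, comp_id_r.
  reflexivity.
Qed.

(** [IsIso] only asserts existence, so a choice principle selects the inverses that serve as
    components of natural transformations. *)
Lemma iso_inverses (A : Category) (I : Type) (a b : I -> A)
  (f : forall i, Hom (a i) (b i)) :
  (forall i, IsIso (f i)) ->
  exists g : forall i, Hom (b i) (a i),
    forall i, g i ∘ f i = idm (a i) /\ f i ∘ g i = idm (b i).
Proof.
  intros H.
  exists (fun i => proj1_sig (constructive_indefinite_description _ (H i))).
  intros i. destruct (constructive_indefinite_description _ (H i)) as [g E].
  exact E.
Qed.

(* As [T ≅ L], transformations out of [T] are also determined by their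
   restrictions along [G]; [k] is the transformation that then plays the role of [l]. *)
Lemma kan_separates_iso (A B D : Category) (F : Functor A D) (G : Functor A B)
  (L : Functor B D) (l : NatTrans F (compF L G)) (kan : IsLeftKan l)
  (T : Functor B D) (i : NatTrans T L) (i_iso : forall b, IsIso (i b))
  (K : A -> D) (k : forall a, Hom (K a) (T (G a)))
  (r : forall a, Hom (K a) (F a)) (r_iso : forall a, IsIso (r a))
  (ik : forall a, i (G a) ∘ k a = (l a : Hom (F a) (L (G a))) ∘ r a)
  (X : Functor B D) (u v : NatTrans T X) :
  (forall a, u (G a) ∘ k a = v (G a) ∘ k a) -> forall b, u b = v b.
Proof.
  intros E.
  destruct (iso_inverses i_iso) as [j Ej].
  assert (j_nat : forall a b (f : Hom a b), j b ∘ fmap L f = fmap T f ∘ j a).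
  { intros a b f. apply (iso_cancel_l (i_iso b)).
    rewrite <- !comp_assoc, naturality, (proj2 (Ej b)), comp_id_l.
    rewrite comp_assoc, (proj2 (Ej a)), comp_id_r. reflexivity. }
  assert (nat : forall w : NatTrans T X, forall a b (f : Hom a b),
    w b ∘ j b ∘ fmap L f = fmap X f ∘ (w a ∘ j a)).
  { intros w a b f. rewrite comp_assoc, j_nat, <- !comp_assoc, naturality.
    reflexivity. }
  pose (pull := fun w : NatTrans T X => @Build_NatTrans _ _ L X (fun b => w b ∘ j b) (nat w)).
  assert (pull_l : forall (w : NatTrans T X) a,
    pull w (G a) ∘ (l a : Hom (F a) (L (G a))) ∘ r a = w (G a) ∘ k a).
  { intros w a. rewrite comp_assoc, <- ik. cbn.
    rewrite comp_assoc, <- (comp_assoc (j _)), (proj1 (Ej _)), comp_id_l.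
    reflexivity. }
  assert (P : forall b, u b ∘ j b = v b ∘ j b).
  { apply (kan_separates kan (u := pull u) (v := pull v)). intros a.
    apply (iso_cancel_r (r_iso a)). rewrite !pull_l. apply E. }
  intros b.
  rewrite <- (comp_id_r (u b)), <- (comp_id_r (v b)), <- (proj1 (Ej b)).
  rewrite <- !comp_assoc, P. reflexivity.
Qed.

(** * Functors built from the tensor product *)

Lemma tensM_id (D : MonoidalCategory) (a b : D) : idm a ⊗₁ idm b = idm (a ⊗ b).
Proof. exact (@fmap_id _ _ (tensor D) (a, b)). Qed.

Lemma tensM_slide (D : MonoidalCategory) (a a' b b' : D)
  (f : Hom a a') (g : Hom b b') :
  (f ⊗₁ idm b') ∘ (idm a ⊗₁ g) = (idm a' ⊗₁ g) ∘ (f ⊗₁ idm b).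
Proof. rewrite <- !tensM_comp, !comp_id_l, !comp_id_r. reflexivity. Qed.

Definition tensL (D : MonoidalCategory) (d : D) : Functor D D.
Proof.
  refine {| fobj := fun x : D => d ⊗ x; fmap := fun _ _ f => idm d ⊗₁ f |}.
  - intros a. apply tensM_id.
  - intros a b c g f. rewrite <- tensM_comp, comp_id_l. reflexivity.
Defined.

Definition tensR (D : MonoidalCategory) (d : D) : Functor D D.
Proof.
  refine {| fobj := fun x : D => x ⊗ d; fmap := fun _ _ f => f ⊗₁ idm d |}.
  - intros a. apply tensM_id.
  - intros a b c g f. rewrite <- tensM_comp, comp_id_l. reflexivity.
Defined.

(** Bracketed to the right, unlike [tens3F]: composed with [L] it is the common target of the two
    sides of the associativity law. *)
Definition tens3R (D : MonoidalCategory) : Functor (prodC (prodC D D) D) D.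
Proof.
  refine (@Build_Functor (prodC (prodC D D) D) D
    (fun x => fst (fst x) ⊗ (snd (fst x) ⊗ snd x))
    (fun _ _ f => fst (fst f) ⊗₁ (snd (fst f) ⊗₁ snd f)) _ _).
  - intros x. cbn. rewrite !tensM_id. reflexivity.
  - intros x y z g f. cbn. rewrite !tensM_comp. reflexivity.
Defined.

(** * The multiplication on [L] compatible with λ *)

Section Extension.
Context (C C' D : MonoidalCategory) (F : LaxFunctor C D) (G : LaxFunctor C C')
  (L : Functor C' D) (l : NatTrans F (compF L G)).

(* [l c] at its unfolded type, so that rewriting sees [L (G c)] and not [compF L G c]. *)
Definition lam (c : C) : Hom (F c) (L (G c)) := l c.

Lemma lam_natural (a b : C) (f : Hom a b) :
  lam b ∘ fmap F f = fmap L (fmap G f) ∘ lam a.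
Proof. exact (naturality l f). Qed.

(** The multiplicative half of [IsMonoidal] for [l], stated for a bare transformation [m] because no
    lax structure on [L] is available yet. *)
Definition extends_mu (m : NatTrans (tens2F L) (compF L (tensor C'))) : Prop :=
  forall c c', fmap L (muF G c c') ∘ mult_at m (G c) (G c') ∘ (lam c ⊗₁ lam c')
               = lam (c ⊗ c') ∘ muF F c c'.

Definition extends_eta (e : Hom (munit D) (L (munit C'))) : Prop :=
  fmap L (etaF G) ∘ e = lam (munit C) ∘ etaF F.

Lemma extends_mu_unique (kan2 : IsLeftKan (tens2_along l)) (G_strong : IsStrong G)
  (m m' : NatTrans (tens2F L) (compF L (tensor C'))) :
  extends_mu m -> extends_mu m' -> m = m'.
Proof.
  intros E E'. apply NatTrans_ext, (kan_separates kan2).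
  intros [c c'].
  change (mult_at m (G c) (G c') ∘ (lam c ⊗₁ lam c')
          = mult_at m' (G c) (G c') ∘ (lam c ⊗₁ lam c')).
  apply (iso_cancel_l (IsIso_fmap L (proj2 G_strong c c'))).
  rewrite <- !comp_assoc, E, E'. reflexivity.
Qed.

Lemma extends_mu_exists (kan2 : IsLeftKan (tens2_along l)) (G_strong : IsStrong G) :
  exists m, extends_mu m.
Proof.
  destruct (iso_inverses (a := fun x : C * C => G (fst x) ⊗ G (snd x))
              (f := fun x => muF G (fst x) (snd x))
              (fun x => proj2 G_strong (fst x) (snd x))) as [inv' inv_r'].
  pose (inv := fun c c' => inv' (c, c') : Hom (G (c ⊗ c')) (G c ⊗ G c')).
  assert (inv_r : forall c c', muF G c c' ∘ inv c c' = idm _).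
  { intros c c'. exact (proj2 (inv_r' (c, c'))). }
  (* The condition [extends_mu] solved for the restriction of [m] along [G × G]; it remains to see
     that this is natural. *)
  unshelve epose (y := @Build_NatTrans _ _ (tens2F F)
    (compF (compF L (tensor C')) (prodF G G))
    (fun x => fmap L (inv (fst x) (snd x))
              ∘ lam (fst x ⊗ snd x) ∘ muF F (fst x) (snd x)) _).
  { intros [a b] [a' b'] [f g].
    change (fmap L (inv a' b') ∘ lam (a' ⊗ b') ∘ muF F a' b'
              ∘ (fmap F f ⊗₁ fmap F g)
            = fmap L (fmap G f ⊗₁ fmap G g)
              ∘ (fmap L (inv a b) ∘ lam (a ⊗ b) ∘ muF F a b)).
    unfold muF at 1. rewrite comp_assoc, mult_natural, <- comp_assoc.
    rewrite (comp_assoc _ (lam _)), lam_natural, <- !comp_assoc, <- !fmap_comp.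
    do 3 f_equal.
    (* Naturality of [inv] follows from that of the multiplication of [G] after composing with
       [muF G a' b']. *)
    apply (iso_cancel_l (proj2 G_strong a' b')).
    rewrite <- !comp_assoc, inv_r, comp_id_l.
    unfold muF at 1. rewrite mult_natural, comp_assoc.
    change (mult_at (mult (lax_structure G)) a b) with (muF G a b).
    rewrite inv_r, comp_id_r. reflexivity. }
  destruct (kan2 _ y) as [m [Em _]].
  exists m. intros c c'.
  assert (E : mult_at m (G c) (G c') ∘ (lam c ⊗₁ lam c')
              = fmap L (inv c c') ∘ lam (c ⊗ c') ∘ muF F c c').
  { exact (NatTrans_eq_at Em (c, c')). }
  rewrite comp_assoc, E, <- !comp_assoc, <- fmap_comp, inv_r, fmap_id, comp_id_l.
  reflexivity.
Qed.

(** * The unit laws *)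

Lemma extends_lunit (kan1 : IsLeftKan l) (e : Hom (munit D) (L (munit C')))
  (m : NatTrans (tens2F L) (compF L (tensor C')))
  (He : extends_eta e) (Hm : extends_mu m) (x : C') :
  fmap L (lunit x) ∘ mult_at m (munit C') x ∘ (e ⊗₁ idm (L x)) = lunit (L x).
Proof.
  pose (T := compF (tensL (munit D)) L).
  unshelve epose (u := @Build_NatTrans _ _ T L
    (fun x => fmap L (lunit x) ∘ mult_at m (munit C') x ∘ (e ⊗₁ idm (L x))) _).
  { intros a b f.
    change (fmap L (lunit b) ∘ mult_at m (munit C') b ∘ (e ⊗₁ idm (L b))
              ∘ (idm (munit D) ⊗₁ fmap L f)
            = fmap L f
              ∘ (fmap L (lunit a) ∘ mult_at m (munit C') a ∘ (e ⊗₁ idm (L a)))).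
    rewrite comp_assoc, tensM_slide, <- (fmap_id L (munit C')), <- comp_assoc.
    rewrite (comp_assoc _ (mult_at _ _ _)), mult_natural, <- !comp_assoc.
    rewrite <- !fmap_comp, lunit_natural. reflexivity. }
  pose (v := @Build_NatTrans _ _ T L (fun x => lunit (L x))
               (fun a b f => lunit_natural (fmap L f))).
  (* The right-hand side [v] of the law is itself the isomorphism from [T] to [L]; its naturality
     against [lam c] relates [k] to [l]. *)
  refine (kan_separates_iso kan1 (i := v) _ (K := fun c => munit D ⊗ F c)
            (k := fun c => idm (munit D) ⊗₁ lam c)
            (r := fun c => lunit (F c)) _ _ (u := u) (v := v) _ x).
  { intros b. apply lunit_iso. }
  { intros c. apply lunit_iso. }
  { intros c. apply lunit_natural. }
  intros c.
  change (fmap L (lunit (G c)) ∘ mult_at m (munit C') (G c) ∘ (e ⊗₁ idm (L (G c)))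
            ∘ (idm (munit D) ⊗₁ lam c) = lunit (L (G c)) ∘ (idm (munit D) ⊗₁ lam c)).
  (* Naturality of [m] moves [etaF G] next to [e], where [He] trades the pair for [etaF F]. *)
  assert (E : fmap L (etaF G ⊗₁ idm (G c)) ∘ mult_at m (munit C') (G c)
              ∘ (e ⊗₁ lam c)
              = mult_at m (G (munit C)) (G c)
                ∘ (lam (munit C) ⊗₁ lam c) ∘ (etaF F ⊗₁ idm (F c))).
  { rewrite <- mult_natural, !comp_assoc, <- !tensM_comp, He, fmap_id.
    rewrite comp_id_l, comp_id_r. reflexivity. }
  unfold extends_mu, muF, etaF in *.
  (* Expanding [lunit (G c)] by the unit law of [G] produces the factor [etaF G] required by [E].
     Then [Hm] turns [m] into the multiplication of [F], whose unit law concludes. *)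
  rewrite <- (lax_lunit (lax_structure G) c), !fmap_comp, !comp_assoc.
  rewrite <- tensM_comp, comp_id_l, comp_id_r.
  rewrite !comp_assoc in E. rewrite E.
  rewrite <- !comp_assoc, !(comp_assoc (fmap L (fmap G (lunit c)))), Hm.
  rewrite <- !comp_assoc, <- lam_natural, lunit_natural.
  rewrite <- (lax_lunit (lax_structure F) c), !comp_assoc.
  reflexivity.
Qed.

(** Mirror image of [extends_lunit], with [L ⊗ e] as the source. *)
Lemma extends_runit (kan1 : IsLeftKan l) (e : Hom (munit D) (L (munit C')))
  (m : NatTrans (tens2F L) (compF L (tensor C')))
  (He : extends_eta e) (Hm : extends_mu m) (x : C') :
  fmap L (runit x) ∘ mult_at m x (munit C') ∘ (idm (L x) ⊗₁ e) = runit (L x).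
Proof.
  pose (T := compF (tensR (munit D)) L).
  unshelve epose (u := @Build_NatTrans _ _ T L
    (fun x => fmap L (runit x) ∘ mult_at m x (munit C') ∘ (idm (L x) ⊗₁ e)) _).
  { intros a b f.
    change (fmap L (runit b) ∘ mult_at m b (munit C') ∘ (idm (L b) ⊗₁ e)
              ∘ (fmap L f ⊗₁ idm (munit D))
            = fmap L f
              ∘ (fmap L (runit a) ∘ mult_at m a (munit C') ∘ (idm (L a) ⊗₁ e))).
    rewrite comp_assoc, <- tensM_slide, <- (fmap_id L (munit C')), <- comp_assoc.
    rewrite (comp_assoc _ (mult_at _ _ _)), mult_natural, <- !comp_assoc.
    rewrite <- !fmap_comp, runit_natural. reflexivity. }
  pose (v := @Build_NatTrans _ _ T L (fun x => runit (L x))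
               (fun a b f => runit_natural (fmap L f))).
  refine (kan_separates_iso kan1 (i := v) _ (K := fun c => F c ⊗ munit D)
            (k := fun c => lam c ⊗₁ idm (munit D))
            (r := fun c => runit (F c)) _ _ (u := u) (v := v) _ x).
  { intros b. apply runit_iso. }
  { intros c. apply runit_iso. }
  { intros c. apply runit_natural. }
  intros c.
  change (fmap L (runit (G c)) ∘ mult_at m (G c) (munit C') ∘ (idm (L (G c)) ⊗₁ e)
            ∘ (lam c ⊗₁ idm (munit D)) = runit (L (G c)) ∘ (lam c ⊗₁ idm (munit D))).
  assert (E : fmap L (idm (G c) ⊗₁ etaF G) ∘ mult_at m (G c) (munit C')
              ∘ (lam c ⊗₁ e)
              = mult_at m (G c) (G (munit C))
                ∘ (lam c ⊗₁ lam (munit C)) ∘ (idm (F c) ⊗₁ etaF F)).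
  { rewrite <- mult_natural, !comp_assoc, <- !tensM_comp, He, fmap_id.
    rewrite comp_id_l, comp_id_r. reflexivity. }
  unfold extends_mu, muF, etaF in *.
  rewrite <- (lax_runit (lax_structure G) c), !fmap_comp, !comp_assoc.
  rewrite <- tensM_comp, comp_id_l, comp_id_r.
  rewrite !comp_assoc in E. rewrite E.
  rewrite <- !comp_assoc, !(comp_assoc (fmap L (fmap G (runit c)))), Hm.
  rewrite <- !comp_assoc, <- lam_natural, runit_natural.
  rewrite <- (lax_runit (lax_structure F) c), !comp_assoc.
  reflexivity.
Qed.

(** * The associativity law *)

Lemma extends_assoc (kan3 : IsLeftKan (tens3_along l)) (G_strong : IsStrong G)
  (m : NatTrans (tens2F L) (compF L (tensor C'))) (Hm : extends_mu m)
  (x y z : C') :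
  fmap L (assoc x y z) ∘ mult_at m (x ⊗ y) z ∘ (mult_at m x y ⊗₁ idm (L z))
  = mult_at m x (y ⊗ z) ∘ (idm (L x) ⊗₁ mult_at m y z) ∘ assoc (L x) (L y) (L z).
Proof.
  pose (X := compF L (tens3R C')).
  unshelve epose (u := @Build_NatTrans _ _ (tens3F L) X
    (fun '(x, y, z) =>
      fmap L (assoc x y z) ∘ mult_at m (x ⊗ y) z ∘ (mult_at m x y ⊗₁ idm (L z))) _).
  { intros [[a b] c] [[a' b'] c'] [[f g] h].
    change (fmap L (assoc a' b' c') ∘ mult_at m (a' ⊗ b') c'
              ∘ (mult_at m a' b' ⊗₁ idm (L c'))
              ∘ ((fmap L f ⊗₁ fmap L g) ⊗₁ fmap L h)
            = fmap L (f ⊗₁ (g ⊗₁ h))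
              ∘ (fmap L (assoc a b c) ∘ mult_at m (a ⊗ b) c
                 ∘ (mult_at m a b ⊗₁ idm (L c)))).
    rewrite comp_assoc, <- tensM_comp, mult_natural, comp_id_l.
    rewrite <- (comp_id_r (fmap L h)), tensM_comp, comp_assoc.
    rewrite <- (comp_assoc (mult_at m (a' ⊗ b') c')), mult_natural.
    rewrite <- !comp_assoc, <- !fmap_comp, assoc_natural. reflexivity. }
  unshelve epose (v := @Build_NatTrans _ _ (tens3F L) X
    (fun '(x, y, z) =>
      mult_at m x (y ⊗ z) ∘ (idm (L x) ⊗₁ mult_at m y z)
      ∘ assoc (L x) (L y) (L z)) _).
  { intros [[a b] c] [[a' b'] c'] [[f g] h].
    change (mult_at m a' (b' ⊗ c') ∘ (idm (L a') ⊗₁ mult_at m b' c')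
              ∘ assoc (L a') (L b') (L c')
              ∘ ((fmap L f ⊗₁ fmap L g) ⊗₁ fmap L h)
            = fmap L (f ⊗₁ (g ⊗₁ h))
              ∘ (mult_at m a (b ⊗ c) ∘ (idm (L a) ⊗₁ mult_at m b c)
                 ∘ assoc (L a) (L b) (L c))).
    rewrite comp_assoc, assoc_natural, !comp_assoc.
    rewrite <- (comp_assoc (idm (L a') ⊗₁ _)), <- tensM_comp, mult_natural, comp_id_l.
    rewrite <- (comp_id_r (fmap L f)), tensM_comp.
    rewrite <- !comp_assoc, mult_natural. reflexivity. }
  refine (kan_separates kan3 (u := u) (v := v) _ ((x, y), z)).
  intros [[a b] c].
  change (fmap L (assoc (G a) (G b) (G c)) ∘ mult_at m (G a ⊗ G b) (G c)
            ∘ (mult_at m (G a) (G b) ⊗₁ idm (L (G c)))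
            ∘ ((lam a ⊗₁ lam b) ⊗₁ lam c)
          = mult_at m (G a) (G b ⊗ G c) ∘ (idm (L (G a)) ⊗₁ mult_at m (G b) (G c))
            ∘ assoc (L (G a)) (L (G b)) (L (G c))
            ∘ ((lam a ⊗₁ lam b) ⊗₁ lam c)).
  (* Compose with [L] of the right-bracketed triple multiplication of [G], an isomorphism, to make
     the laws of [G] and [F] applicable. *)
  apply (@iso_cancel_l _ _ _ _
           (fmap L (muF G a (b ⊗ c) ∘ (idm (G a) ⊗₁ muF G b c)))).
  { apply IsIso_fmap, IsIso_comp, IsIso_tens_l; apply G_strong. }
  (* [E1] and [E2] carry the left- and right-bracketed triple multiplications of [L] to those of
     [F], by using [Hm] twice with naturality of [m] in between. *)
  assert (E1 : fmap L (muF G (a ⊗ b) c ∘ (muF G a b ⊗₁ idm (G c)))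
               ∘ mult_at m (G a ⊗ G b) (G c)
               ∘ (mult_at m (G a) (G b) ⊗₁ idm (L (G c)))
               ∘ ((lam a ⊗₁ lam b) ⊗₁ lam c)
               = lam ((a ⊗ b) ⊗ c) ∘ muF F (a ⊗ b) c ∘ (muF F a b ⊗₁ idm (F c))).
  { rewrite <- Hm, fmap_comp, !comp_assoc, <- !tensM_comp.
    rewrite <- (comp_assoc (fmap L (muF G a b ⊗₁ _))), <- mult_natural.
    rewrite comp_assoc, <- tensM_comp, fmap_id, !comp_id_l, comp_id_r.
    rewrite <- Hm, !comp_assoc. reflexivity. }
  assert (E2 : fmap L (muF G a (b ⊗ c) ∘ (idm (G a) ⊗₁ muF G b c))
               ∘ mult_at m (G a) (G b ⊗ G c)
               ∘ (idm (L (G a)) ⊗₁ mult_at m (G b) (G c))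
               ∘ (lam a ⊗₁ (lam b ⊗₁ lam c))
               = lam (a ⊗ (b ⊗ c)) ∘ muF F a (b ⊗ c) ∘ (idm (F a) ⊗₁ muF F b c)).
  { rewrite <- Hm, fmap_comp, !comp_assoc, <- !tensM_comp.
    rewrite <- (comp_assoc (fmap L (idm _ ⊗₁ _))), <- mult_natural.
    rewrite comp_assoc, <- tensM_comp, fmap_id, !comp_id_l, comp_id_r.
    rewrite <- Hm, !comp_assoc. reflexivity. }
  (* Sliding the associator past the components of λ makes [E2] apply on the right. On the left,
     associativity of [G] gives the form of [E1], and associativity of [F] joins the two. *)
  rewrite (comp_assoc _ (assoc _ _ _)), assoc_natural.
  rewrite <- !comp_assoc, E2, <- fmap_comp.
  assert (EG := lax_assoc (lax_structure G) a b c).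
  assert (EF := lax_assoc (lax_structure F) a b c).
  unfold muF in *. rewrite <- EG, (comp_assoc (fmap G _)), (fmap_comp L (fmap G _)).
  rewrite !comp_assoc in E1 |- *. rewrite E1, <- (comp_assoc (fmap L _)).
  rewrite <- lam_natural, !comp_assoc. rewrite !comp_assoc in EF. rewrite EF.
  reflexivity.
Qed.

(** * Existence and uniqueness of the lax structure *)

Lemma extends_lax_exists (kan1 : IsLeftKan l) (kan2 : IsLeftKan (tens2_along l))
  (kan3 : IsLeftKan (tens3_along l)) (G_strong : IsStrong G) :
  exists S : LaxStructure L, extends_eta (eta S) /\ extends_mu (mult S).
Proof.
  destruct (extends_mu_exists kan2 G_strong) as [m Hm].
  destruct (IsIso_fmap L (proj1 G_strong)) as [k [_ Ek]].
  pose (e := k ∘ (lam (munit C) ∘ etaF F)).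
  assert (He : extends_eta e).
  { unfold extends_eta, e. rewrite <- comp_assoc, Ek, comp_id_l. reflexivity. }
  exists {| eta := e; mult := m;
            lax_assoc := extends_assoc kan3 G_strong Hm;
            lax_lunit := extends_lunit kan1 He Hm;
            lax_runit := extends_runit kan1 He Hm |}.
  split; assumption.
Qed.

Lemma extends_lax_unique (kan2 : IsLeftKan (tens2_along l)) (G_strong : IsStrong G)
  (S T : LaxStructure L) :
  extends_eta (eta S) -> extends_mu (mult S) ->
  extends_eta (eta T) -> extends_mu (mult T) -> S = T.
Proof.
  intros eS mS eT mT. apply LaxStructure_ext.
  - apply (iso_cancel_l (IsIso_fmap L (proj1 G_strong))).
    rewrite eS, eT. reflexivity.
  - exact (extends_mu_unique kan2 G_strong mS mT).
Qed.

(** * The universal property among monoidal transformations *)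

(** A converse to [mon_paste], which makes the transformation found in Cat monoidal. The unit
    condition is tested after the isomorphism [fmap X (etaF G)]; the multiplicative one compares two
    transformations out of [L ⊗ L], so [kan2] reduces it to the image of [G × G]. *)
Lemma paste_monoidal_reflect (kan2 : IsLeftKan (tens2_along l))
  (G_strong : IsStrong G) (S : LaxStructure L)
  (He : extends_eta (eta S)) (Hm : extends_mu (mult S))
  (X : LaxFunctor C' D) (u : NatTrans L X) :
  IsMonoidal (H := F) (K := compLax X G) (paste l u) ->
  IsMonoidal (H := Build_LaxFunctor S) (K := X) u.
Proof.
  intros [y0 y2]. split.
  - change (fmap X (etaF G) ∘ etaF X
            = u (G (munit C)) ∘ lam (munit C) ∘ etaF F) in y0.
    change (etaF X = u (munit C') ∘ eta S).
    apply (iso_cancel_l (IsIso_fmap X (proj1 G_strong))).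
    rewrite y0, <- comp_assoc, <- naturality, !comp_assoc, He. reflexivity.
  - change (forall c c', fmap X (muF G c c') ∘ muF X (G c) (G c')
              ∘ ((u (G c) ∘ lam c) ⊗₁ (u (G c') ∘ lam c'))
            = u (G (c ⊗ c')) ∘ lam (c ⊗ c') ∘ muF F c c') in y2.
    change (forall x x', muF X x x' ∘ (u x ⊗₁ u x')
                         = u (x ⊗ x') ∘ mult_at (mult S) x x').
    unshelve epose (p := @Build_NatTrans _ _ (tens2F L) (compF X (tensor C'))
      (fun '(a, b) => muF X a b ∘ (u a ⊗₁ u b)) _).
    { intros [a b] [a' b'] [f g].
      change (muF X a' b' ∘ (u a' ⊗₁ u b') ∘ (fmap L f ⊗₁ fmap L g)
              = fmap X (f ⊗₁ g) ∘ (muF X a b ∘ (u a ⊗₁ u b))).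
      unfold muF. rewrite <- comp_assoc, <- mult_natural, !comp_assoc.
      rewrite <- !tensM_comp, !naturality. reflexivity. }
    unshelve epose (q := @Build_NatTrans _ _ (tens2F L) (compF X (tensor C'))
      (fun '(a, b) => u (a ⊗ b) ∘ mult_at (mult S) a b) _).
    { intros [a b] [a' b'] [f g].
      change (u (a' ⊗ b') ∘ mult_at (mult S) a' b' ∘ (fmap L f ⊗₁ fmap L g)
              = fmap X (f ⊗₁ g) ∘ (u (a ⊗ b) ∘ mult_at (mult S) a b)).
      rewrite comp_assoc, mult_natural, <- !comp_assoc, naturality. reflexivity. }
    intros x x'.
    refine (kan_separates kan2 (u := p) (v := q) _ (x, x')).
    intros [c c'].
    change (muF X (G c) (G c') ∘ (u (G c) ⊗₁ u (G c')) ∘ (lam c ⊗₁ lam c')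
            = u (G c ⊗ G c') ∘ mult_at (mult S) (G c) (G c') ∘ (lam c ⊗₁ lam c')).
    apply (iso_cancel_l (IsIso_fmap X (proj2 G_strong c c'))).
    rewrite (comp_assoc (muF X _ _)), <- tensM_comp, <- comp_assoc, y2.
    rewrite <- !comp_assoc, <- naturality, !comp_assoc, <- Hm, !comp_assoc.
    reflexivity.
Qed.

End Extension.

Theorem theorem2p1 (C C' D : MonoidalCategory)
  (F : LaxFunctor C D) (G : LaxFunctor C C') (G_strong : IsStrong G)
  (L : Functor C' D) (l : NatTrans F (compF L G))
  (kan1 : IsLeftKan l)
  (kan2 : IsLeftKan (tens2_along l))
  (kan3 : IsLeftKan (tens3_along l)) :
  (exists! S : LaxStructure L,
      IsMonoidal (H := F) (K := compLax (Build_LaxFunctor S) G) l) /\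
  (forall (S : LaxStructure L)
          (l_mon : IsMonoidal (H := F) (K := compLax (Build_LaxFunctor S) G) l),
      IsMonLeftKan (Build_MonNatTrans l_mon)).
Proof.
  split.
  - destruct (extends_lax_exists kan1 kan2 kan3 G_strong) as [S [eS mS]].
    (* [extends_eta] and [extends_mu] are, by conversion, the two halves of [IsMonoidal]. *)
    exists S. split; [exact (conj eS mS) |].
    intros T [eT mT]. exact (extends_lax_unique kan2 G_strong eS mS eT mT).
  - intros S l_mon X [y y_mon].
    (* The factorization in Cat makes [y] equal to [paste l u], so monoidality of [y] reflects to
       [u]. *)
    destruct (kan1 X y) as [u [Eu Hu]]. subst y.
    exists (Build_MonNatTrans
              (paste_monoidal_reflect kan2 G_strong
                 (proj1 l_mon) (proj2 l_mon) y_mon)).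
    split.
    + apply MonNatTrans_ext. reflexivity.
    (* Uniqueness is inherited from Cat by forgetting monoidality. *)
    + intros w Ew. apply MonNatTrans_ext. apply Hu.
      exact (f_equal (@mon_nat _ _ _ _) Ew).
Qed.
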